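(* Let $\lambda\approx1.5214$ be the real root and $\mu\approx-0.761+0.858i$ a complex root of $t^3-t-2$, and put $\sigma=\log_{|\mu|}\lambda\approx3.068$. Let $\mathbf Q=\bigoplus\mathbf Q_{n_1n_2n_3}$ be the $\mathbb N_0^3$-grading of $\mathbf Q=\mathrm{Lie}(v_0,v_1,v_2)$ by multidegree in $v_0,v_1,v_2$. For $(n_1,n_2,n_3)$ put $Y_1=n_1+n_2\lambda+n_3\lambda^2$, $Y_2=\operatorname{Re}(n_1+n_2\mu+n_3\mu^2)$, $Y_3=\operatorname{Im}(n_1+n_2\mu+n_3\mu^2)$. Then for every $(n_1,n_2,n_3)$ with $\mathbf Q_{n_1n_2n_3}\neq0$ (i.e. for the multidegree of every standard monomial of $\mathbf Q$), $$\sqrt{Y_2^2+Y_3^2}<14\,Y_1^{1/\sigma}.$$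
   Context: $\Lambda$ is the Grassmann algebra over a field $K$ on odd generators $x_0,x_1,\dots$; $x_i$ acts by left multiplication; $\partial_i$ is the odd superderivation with $\partial_i(x_j)=\delta_{ij}$; pivot elements $v_i=\sum_{k\ge0}\big(\prod_{n=0}^{k-1}x_{i+3n}x_{i+3n+1}\big)\partial_{i+3k}$. $\mathbf Q$ is the Lie subsuperalgebra of $(\operatorname{End}\Lambda)^{(-)}$ generated by $v_0,v_1,v_2$ (closed under squaring of odd elements in characteristic $2$); $\mathbf Q_{n_1n_2n_3}$ is the span of Lie products with $n_1,n_2,n_3$ occurrences of $v_0,v_1,v_2$. *)

(* Defs.v *)
From mathcomp Require Import all_boot all_algebra.
Set Implicit Arguments. Unset Strict Implicit. Unset Printing Implicit Defensive.
Import GRing.Theory.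
Local Open Scope ring_scope.

Section Grassmann.
Variable K : fieldType.

(* A basis monomial x_S = x_{s_1} x_{s_2} ... x_{s_k} of the Grassmann
   algebra Lambda, represented by the strictly increasing list S = [s_1;..;s_k]. *)
Definition mono := seq nat.
Definition is_mono (S : mono) : bool := sorted ltn S.

(* An element of Lambda: a finite formal K-linear combination of basis monomials. *)
Definition elt := seq (K * mono).

Definition coef (f : elt) (w : mono) : K := \sum_(p <- f | p.2 == w) p.1.

(* A K-linear endomorphism of Lambda, given by its values on basis monomials. *)
Definition op := mono -> elt.

Definition ext (A : op) (f : elt) : elt :=
  flatten [seq [seq (p.1 * q.1, q.2) | q <- A p.2] | p <- f].

Definition opcomp (A B : op) : op := fun m => ext A (B m).
Definition opadd (A B : op) : op := fun m => A m ++ B m.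
Definition opscale (c : K) (A : op) : op := fun m => [seq (c * q.1, q.2) | q <- A m].
Definition idop : op := fun S => [:: (1, S)].

Definition sgn_before (i : nat) (S : mono) : K := (-1) ^+ count (fun j => j < i)%N S.

(* left multiplication by x_i *)
Definition xop (i : nat) : op := fun S =>
  if i \in S then [::] else [:: (sgn_before i S, sort leq (i :: S))].

(* the odd superderivation d_i with d_i(x_j) = delta_ij *)
Definition dop (i : nat) : op := fun S =>
  if i \in S then [:: (sgn_before i S, rem i S)] else [::].

Definition pref (i k : nat) : op :=
  foldr (fun n A => opcomp (xop (i + 3 * n)) (opcomp (xop (i + 3 * n).+1) A))
        idop (iota 0 k).

(* pivot element v_i = sum_{k>=0} (prod_{n<k} x_{i+3n} x_{i+3n+1}) d_{i+3k}.
   On a basis monomial x_S only the terms with i+3k in S are nonzero, and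
   those have k <= sumn S, so the infinite sum is the finite sum below. *)
Definition vop (i : nat) : op := fun S =>
  flatten [seq opcomp (pref i k) (dop (i + 3 * k)) S | k <- iota 0 (sumn S).+1].

Definition op_nonzero (A : op) : Prop :=
  exists S w : mono, is_mono S /\ coef (A S) w != 0.

End Grassmann.

(* Lie (super)words in the generators v_0, v_1, v_2: brackets, and squares
   of odd elements (needed in characteristic 2). *)
Inductive lword := LGen of 'I_3 | LBr of lword & lword | LSq of lword.

Fixpoint mdeg (w : lword) : nat * nat * nat :=
  match w with
  | LGen j => if val j == 0%N then (1, 0, 0)%N
              else if val j == 1%N then (0, 1, 0)%N else (0, 0, 1)%N
  | LBr a b => let: (a1, a2, a3) := mdeg a in let: (b1, b2, b3) := mdeg b in
               (a1 + b1, a2 + b2, a3 + b3)%N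
  | LSq a => let: (a1, a2, a3) := mdeg a in (a1.*2, a2.*2, a3.*2)%N
  end.

(* total degree; parity of w is odd (tdeg w), since every v_i is odd *)
Definition tdeg (w : lword) : nat := let: (a1, a2, a3) := mdeg w in (a1 + a2 + a3)%N.

Fixpoint wf (w : lword) : bool :=
  match w with
  | LGen _ => true
  | LBr a b => wf a && wf b
  | LSq a => wf a && odd (tdeg a)
  end.

Fixpoint eval (K : fieldType) (w : lword) : op K :=
  match w with
  | LGen j => vop K (val j)
  | LBr a b =>
      let s : K := if odd (tdeg a) && odd (tdeg b) then 1 else -1 in
      opadd (opcomp (eval K a) (eval K b)) (opscale s (opcomp (eval K b) (eval K a)))
  | LSq a => opcomp (eval K a) (eval K a)
  end.

(* Q_{n1 n2 n3} <> 0: Q_{n} is the span of the Lie products of multidegree n,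
   so it is nonzero iff one of these products is a nonzero operator. *)
Definition Qcomp_nonzero (K : fieldType) (n : nat * nat * nat) : Prop :=
  exists w : lword, [/\ wf w, mdeg w = n & op_nonzero (eval K w)].

(* Main.v *)
(* If v_i has weight a_i, then x_i has weight -a_i, and
   v_i = d_i + x_i x_{i+1} v_{i+3} forces a_{i+3} = a_{i+1} + 2 a_i; the
   functionals Y_1 and Y_2 + i Y_3 send a_i to lambda^i and mu^i.  Elements of Q
   are superderivations, hence determined by their values on the generators x_j.
   The set of terms x_A d_j occurring in the elements x_r v_n, with r contained
   in {0,..,n-3} or in {0,..,n-5} + {n-2}, is closed under
   (x_A d_i, x_B d_j) |-> x_A d_i(x_B) d_j, so every nonzero component of Q has
   weight a_n - sum_{k in r} a_k for such n and r.  If 1 < t and t^2 <= t + 1,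
   then sum_{k in r} t^k <= t^n / ((t - 1) t^2) for both kinds of r.  Taking
   t = lambda and t = |mu| gives Y_1 >= lambda^(n-5) and
   |Y_2 + i Y_3| <= 6.5 |mu|^n, while (lambda^m)^(1/sigma) = |mu|^m and
   6.5 |mu|^5 < 14. *)
From HB Require Import structures.
Require Import Defs.
From Stdlib Require Import Reals Lra.
From Coquelicot Require Import Coquelicot.
From mathcomp Require Import all_boot all_order all_algebra finmap zify.
From mathcomp Require Import boolp functions Rstruct.
Set Implicit Arguments. Unset Strict Implicit. Unset Printing Implicit Defensive.
Import GRing.Theory.

(** * Terms of the pivot elements *)

Section PivotTerms.
Local Open Scope nat_scope.
Implicit Types (A B C r : seq nat) (i j k n : nat).

(* The indices of the coefficient of [d_(n + 3 k)] in [v_n]. *)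
Fixpoint pivot_prefix n k : seq nat :=
  if k is k'.+1 then [:: n, n.+1 & pivot_prefix (n + 3) k'] else [::].

Definition pivot_tail n r : Prop :=
  {in r, forall x, x + 3 <= n} \/ {in r, forall x, x + 2 = n \/ x + 5 <= n}.

(* [x_A d_j] occurs in some product [x_r v_n] with an admissible tail [r]. *)
Definition pivot_term j A : Prop :=
  exists n k r,
    [/\ j = n + 3 * k, perm_eq A (pivot_prefix n k ++ r) & pivot_tail n r].

Lemma pivot_prefix_bounds n k x :
  x \in pivot_prefix n k -> n <= x /\ x + 2 <= n + 3 * k.
Proof.
elim: k n => [//|k IHk] n; rewrite !inE => /or3P[/eqP ->|/eqP ->|/IHk]; lia.
Qed.

Lemma pivot_prefix_uniq n k : uniq (pivot_prefix n k).
Proof.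
elim: k n => //= k IHk n; rewrite IHk inE !andbT !negb_or -andbA.
by apply/and3P; split; first lia; apply/negP => /pivot_prefix_bounds; lia.
Qed.

Lemma size_pivot_prefix n k : size (pivot_prefix n k) = k.*2.
Proof. by elim: k n => //= k IHk n; rewrite IHk. Qed.

Lemma pivot_prefix_split i n k : i \in pivot_prefix n k ->
  exists q l, let m := n + 3 * q in
    [/\ pivot_prefix n k =
          pivot_prefix n q ++ [:: m, m.+1 & pivot_prefix (m + 3) l],
        m + 3 + 3 * l = n + 3 * k & i = m \/ i = m.+1].
Proof.
elim: k n => [//|k IHk] n; rewrite !inE orbA => /orP[/pred2P i_n|].
  by exists 0, k; rewrite /= muln0 addn0; split=> //; lia.
case/IHk => q [l [/= -> m_l i_m]]; exists q.+1, l.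
by rewrite [3 * q.+1]mulnS addnA; split=> //; lia.
Qed.

(* Both indices of the pair containing [i] leave the prefix, and the other one
   joins the tail of a pivot restarting after the pair. *)
Lemma rem_pivot_prefix i n k : i \in pivot_prefix n k ->
  exists m l r,
    [/\ n + 3 * k = m + 3 * l,
        perm_eq (rem i (pivot_prefix n k)) (pivot_prefix m l ++ r) &
        forall s, {in s, forall x, x + 2 <= i} -> pivot_tail m (r ++ s)].
Proof.
move=> i_prefix.
have [q [l [/= eq_prefix <- i_m]]] := pivot_prefix_split i_prefix.
set m := n + 3 * q in eq_prefix i_m *; set m' := if i == m then m.+1 else m.
exists (m + 3), l, (m' :: pivot_prefix n q); split=> // [|s lt_s].
  rewrite -(perm_cons i) perm_sym; apply/permP => a.
  rewrite -(permP (perm_to_rem i_prefix)) eq_prefix /= !count_cat /= /m'.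
  by case: i_m => ->; case: eqP => //; rewrite ?count_cat /=; lia.
have lt_rest x : x \in pivot_prefix n q ++ s -> x + 2 <= i.
  by rewrite mem_cat => /orP[/pivot_prefix_bounds|/lt_s]; lia.
rewrite cat_cons /m'; have [i_eq|i_neq] := eqVneq i m.
  by right=> x; rewrite inE => /predU1P[|/lt_rest]; lia.
by left=> x; rewrite inE => /predU1P[|/lt_rest]; lia.
Qed.

Lemma pivot_term_prefix n k : pivot_term (n + 3 * k) (pivot_prefix n k).
Proof. by exists n, k, [::]; rewrite cats0; split=> //; left. Qed.

Lemma pivot_tail_lt n r : pivot_tail n r -> {in r, forall x, x + 2 <= n}.
Proof. by case=> lt_r x /lt_r; lia. Qed.

Lemma pivot_term_lt i A : pivot_term i A -> {in A, forall x, x + 2 <= i}.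
Proof.
move=> [n [k [r [-> pA /pivot_tail_lt lt_r]]]] x; rewrite (perm_mem pA) mem_cat.
by case/orP=> [/pivot_prefix_bounds|/lt_r]; lia.
Qed.

Lemma pivot_tail_contract A n r i : uniq r -> i \in r ->
  {in A, forall x, x + 2 <= i} -> pivot_tail n r -> pivot_tail n (A ++ rem i r).
Proof.
move=> uniq_r r_i lt_A tail_r.
have in_rest x : x \in A ++ rem i r -> x + 2 <= i \/ x \in r /\ x <> i.
  rewrite mem_cat mem_rem_uniq // inE => /orP[/lt_A|/andP[/eqP x_i r_x]].
    by left.
  by right.
case: tail_r => lt_r; have := lt_r _ r_i.
  by move=> lt_i; left=> x /in_rest[|[/lt_r]]; lia.
by case=> i_n; [left|right] => x /in_rest[|[/lt_r]]; lia.
Qed.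

(* One half of a supercommutator: [x_A d_i] acting on the coefficient of
   [x_B d_j] gives [x_C d_j].  Only the bound on [A] matters, so neither half
   relies on cancellation against the other. *)
Lemma pivot_term_contract A B C i j :
    {in A, forall x, x + 2 <= i} -> uniq B -> pivot_term j B -> i \in B ->
  perm_eq C (A ++ rem i B) -> pivot_term j C.
Proof.
move=> lt_A uniq_B [n [k [r [-> pB tail_r]]]] B_i pC.
have count_C a :
    count a C + a i = count a A + (count a (pivot_prefix n k) + count a r).
  rewrite (permP pC) -count_cat -(permP pB) (permP (perm_to_rem B_i)).
  by rewrite count_cat /=; lia.
have /orP[i_prefix|r_i] : (i \in pivot_prefix n k) || (i \in r).
- by rewrite -mem_cat -(perm_mem pB).
- have [m [l [s [-> p_rem tail_s]]]] := rem_pivot_prefix i_prefix.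
  exists m, l, (s ++ A ++ r); split=> //.
    apply/permP => a; have := count_C a; have := permP p_rem a.
    by rewrite (permP (perm_to_rem i_prefix)) !count_cat /=; lia.
  apply: tail_s => x; rewrite mem_cat => /orP[/lt_A|/(pivot_tail_lt tail_r)] //.
  by have := pivot_prefix_bounds i_prefix; lia.
- exists n, k, (A ++ rem i r); split=> //.
    apply/permP => a; have := count_C a.
    by rewrite (permP (perm_to_rem r_i)) !count_cat /=; lia.
  apply: pivot_tail_contract => //.
  by move: uniq_B; rewrite (perm_uniq pB) cat_uniq => /and3P[].
Qed.

End PivotTerms.

Section Weights.
Local Open Scope ring_scope.
Variables (U : zmodType) (f : nat -> U).

(* Satisfied by the weights of the [v_i]: the identity
   [v_i = d_i + x_i x_(i+1) v_(i+3)] is homogeneous for weights of this kind. *)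
Definition pivot_rec : Prop := forall i, f i.+3 = f i.+1 + f i *+ 2.

Definition weight (d : nat * nat * nat) : U :=
  f 0 *+ d.1.1 + f 1 *+ d.1.2 + f 2 *+ d.2.

Lemma weightD (d e : nat * nat * nat) : weight (d + e) = weight d + weight e.
Proof. by rewrite /weight !mulrnDr [X in X + _ = _]addrACA [LHS]addrACA. Qed.

Lemma sum_pivot_prefix n k : pivot_rec ->
  f n + \sum_(a <- pivot_prefix n k) f a = f (n + 3 * k)%N.
Proof.
move=> rec_f; elim: k n => [|k IHk] n.
  by rewrite big_nil muln0 addn0 addr0.
rewrite mulnS addnA -IHk !big_cons addrA addrA -mulr2n [_ + f n.+1]addrC -rec_f.
by rewrite addn3.
Qed.

End Weights.

(** * Superderivations *)

Section Superderivations.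
Local Open Scope ring_scope.
Variables (K : comNzRingType) (V : lmodType K) (X : nat -> {linear V -> V}).
Hypothesis X_sq : forall i v, X i (X i v) = 0.
Hypothesis X_anti : forall i j v, X i (X j v) = - X j (X i v).
Implicit Types (A B C : seq nat) (L M : V -> V) (b c : bool) (k : K).

Fixpoint xprod A (v : V) : V := if A is a :: A' then X a (xprod A' v) else v.

Inductive in_span (P : seq nat -> Prop) : (V -> V) -> Prop :=
| in_span0 : in_span P (fun=> 0)
| in_span_xprod A of P A : in_span P (xprod A)
| in_span_lin k L M of in_span P L & in_span P M :
    in_span P (fun v => k *: L v + M v).

(* The remainder [L] stands for multiplication by [D(x_i)], whose monomials
   [x_A] satisfy [P i A]. *)
Definition superder (P : nat -> seq nat -> Prop) b (D : V -> V) : Prop :=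
  forall i, exists2 L, in_span (P i) L &
    forall v, D (X i v) = (-1) ^+ b *: X i (D v) + L v.

Lemma xprod_is_linear A : linear (xprod A).
Proof. by elim: A => //= a A IH c u v; rewrite IH linearP. Qed.

HB.instance Definition _ A :=
  GRing.isLinear.Build K V V *:%R (xprod A) (@xprod_is_linear A).

Lemma xprod_cat A B v : xprod (A ++ B) v = xprod A (xprod B v).
Proof. by elim: A => //= a A ->. Qed.

Lemma X_xprod i A v : X i (xprod A v) = (-1) ^+ size A *: xprod A (X i v).
Proof.
elim: A => [|a A IH] /=; first by rewrite scale1r.
by rewrite X_anti IH linearZ /= exprS mulN1r scaleNr.
Qed.

Lemma xprod_non_uniq A v : ~~ uniq A -> xprod A v = 0.
Proof.
elim: A => //= a A IH; rewrite negb_and negbK.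
case/orP=> [|/IH ->]; last exact: linear0.
case/splitPr=> A1 A2; rewrite xprod_cat X_xprod /= X_sq.
by rewrite linear0 scaler0.
Qed.

Lemma in_span_eq P L M : in_span P L -> L =1 M -> in_span P M.
Proof. by move=> + /funext <-. Qed.

Lemma in_span_sub (P Q : seq nat -> Prop) L :
  (forall A, P A -> Q A) -> in_span P L -> in_span Q L.
Proof.
by move=> PQ; elim=> [|A /PQ|k L1 L2 _ ? _ ?]; by [left|right|constructor].
Qed.

Lemma superder_sub (P Q : nat -> seq nat -> Prop) b D :
  (forall i A, P i A -> Q i A) -> superder P b D -> superder Q b D.
Proof.
move=> PQ derD i; have [L spanL DX] := derD i; exists L => //.
exact: in_span_sub (@PQ i) spanL.
Qed.

Lemma in_span_uniq P L : in_span P L -> in_span (fun A => P A /\ uniq A) L.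
Proof.
elim=> [|A PA|k L1 L2 _ sL1 _ sL2]; [exact: in_span0| |exact: in_span_lin].
have [uA|nuA] := boolP (uniq A); first exact: in_span_xprod.
by apply: in_span_eq (in_span0 _) _ => v; rewrite xprod_non_uniq.
Qed.

Lemma in_span_empty P L : (forall A, ~ P A) -> in_span P L -> L =1 fun=> 0.
Proof.
move=> P0; elim=> [//|A /P0//|k L1 L2 _ L1_0 _ L2_0] v.
by rewrite L1_0 L2_0 scaler0 addr0.
Qed.

Lemma in_span_x_comp P L a :
  in_span P L -> in_span (fun C => exists2 A, C = a :: A & P A) (X a \o L).
Proof.
elim=> [|A PA|k L1 L2 _ sL1 _ sL2].
- by apply: in_span_eq (in_span0 _) _ => v /=; rewrite linear0.
- by apply: (@in_span_xprod _ (a :: A)); exists A.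
- by apply: in_span_eq (in_span_lin k sL1 sL2) _ => v /=; rewrite linearP.
Qed.

Lemma in_span_comp_xprod P L B :
  in_span P L -> in_span (fun C => exists2 A, C = A ++ B & P A) (L \o xprod B).
Proof.
elim=> [|A PA|k L1 L2 _ sL1 _ sL2]; [exact: in_span0| |exact: in_span_lin].
apply: in_span_eq (@in_span_xprod _ (A ++ B) _) _; first by exists A.
by move=> v; rewrite xprod_cat.
Qed.

(* The monomials that [x_B d_i] with [P i B] produces from [x_A]. *)
Definition contracted (P : nat -> seq nat -> Prop) A C : Prop :=
  exists i B, [/\ i \in A, P i B & perm_eq C (B ++ rem i A)].

Lemma contracted_cons P a A C :
  contracted P A C -> contracted P (a :: A) (a :: C).
Proof.
move=> [i [B [A_i PB pC]]]; exists i, B; split=> //.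
  by rewrite inE A_i orbT.
apply/permP => p; rewrite /= (permP pC) !count_cat.
by have := permP (perm_to_rem A_i) p; case: eqP => [->|_] /=; lia.
Qed.

Lemma superder_xprod P b (D : {linear V -> V}) A : superder P b D ->
  exists2 L, in_span (contracted P A) L &
    forall v, D (xprod A v) = (-1) ^+ (b * size A) *: xprod A (D v) + L v.
Proof.
move=> derD; elim: A => [|a A [L spanL DL]].
  exists (fun=> 0); first exact: in_span0.
  by move=> v; rewrite muln0 scale1r addr0.
have [M spanM DM] := derD a.
exists (fun v => (-1) ^+ b *: X a (L v) + M (xprod A v)); last first.
  move=> v /=; rewrite DM DL linearD linearZ /= scalerDr scalerA -exprD mulnS.
  by rewrite addrA.
apply: in_span_lin.
  apply: in_span_sub (in_span_x_comp a spanL) => _ [C ->].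
  exact: contracted_cons.
apply: in_span_sub (in_span_comp_xprod A spanM) => _ [B -> PB].
by exists a, B; rewrite mem_head /= eqxx.
Qed.

Lemma superder_span P Q R b c (D : {linear V -> V}) L :
    superder P b D -> in_span Q L ->
    (forall A, Q A -> odd (size A) = c) ->
    (forall A C, Q A -> contracted P A C -> uniq C -> R C) ->
  exists2 M, in_span R M &
    forall v, D (L v) = (-1) ^+ (b && c) *: L (D v) + M v.
Proof.
move=> derD + parQ QR; elim=> [|A QA|a L1 L2 _ [M1 sM1 DL1] _ [M2 sM2 DL2]].
- exists (fun=> 0); first exact: in_span0.
  by move=> v; rewrite linear0 scaler0 addr0.
- have [M spanM DM] := superder_xprod A derD; exists M => [|v].
    by apply: in_span_sub (in_span_uniq spanM) => C [? ?]; apply: QR QA _ _.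
  by rewrite DM -signr_odd oddM (parQ _ QA) oddb.
- exists (fun v => a *: M1 v + M2 v); first exact: in_span_lin.
  move=> v; rewrite linearP DL1 DL2 !scalerDr !scalerA [a * _]mulrC.
  by rewrite addrACA.
Qed.

Definition superbracket b c (D E : V -> V) : V -> V :=
  fun v => D (E v) - (-1) ^+ (b && c) *: E (D v).

Lemma superder_bracket P Q R b c (D E : {linear V -> V}) :
    superder P b D -> superder Q c E ->
    (forall i A, P i A -> odd (size A) = ~~ b) ->
    (forall i A, Q i A -> odd (size A) = ~~ c) ->
    (forall i A C, Q i A -> contracted P A C -> uniq C -> R i C) ->
    (forall i A C, P i A -> contracted Q A C -> uniq C -> R i C) ->
  superder R (b (+) c) (superbracket b c D E).
Proof.
move=> derD derE parP parQ QR PR i.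
have [L spanL DX] := derD i; have [M spanM EX] := derE i.
have [M' spanM' DM] := superder_span derD spanM (@parQ i) (@QR i).
have [L' spanL' EL] := superder_span derE spanL (@parP i) (@PR i).
exists (fun v => M' v - (-1) ^+ (b && c) *: L' v) => [|v].
  apply: in_span_eq (in_span_lin (- (-1) ^+ (b && c)) spanL' spanM') _ => v.
  by rewrite scaleNr addrC.
have cross_cancel (p q x y m l : V) :
    p + x + (y + m) - (q + y + (x + l)) = p - q + (m - l).
  rewrite [y + m]addrC addrACA [x + l]addrC [X in - X]addrACA [y + x]addrC.
  by rewrite [q + l + _]addrC addrKA opprD addrACA.
have sign_L : (b && c) (+) (c && ~~ b) = c by case: (b); case: (c).
have sign_M : b && ~~ c = (b && c) (+) b by case: (b); case: (c).
rewrite /superbracket EX DX (linearP D) (linearP E).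
rewrite (linearB (X i)) (linearZ_LR (X i)) /=.
rewrite DX EX DM EL sign_M !(scalerDr, scalerN) !scalerA -!signr_addb sign_L.
rewrite cross_cancel [b (+) c]addbC -addbA [(b && c) (+) _]addbC.
by rewrite [b (+) c]addbC.
Qed.

Lemma superder_square P R (D : {linear V -> V}) : superder P true D ->
  (forall i A, P i A -> ~~ odd (size A)) ->
  (forall i A C, P i A -> contracted P A C -> uniq C -> R i C) ->
  superder R false (D \o D).
Proof.
move=> derD parP PR i; have [L spanL DX] := derD i.
have parP_i A : P i A -> odd (size A) = false by move/parP/negPf.
have [M spanM DL] := superder_span derD spanL parP_i (@PR i).
exists M => // v /=; rewrite DX linearD linearZ /= DX DL /= !scaleN1r !scale1r.
by rewrite opprD opprK addrA subrK.
Qed.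

End Superderivations.

(** * Multidegrees of the terms of a superderivation *)

Section Multidegrees.
Local Open Scope ring_scope.
Implicit Types (d e : nat * nat * nat) (A C : seq nat) (i j : nat) (w : lword).

(* The possible monomials [x_A] in the image of [x_i] under an element of
   multidegree [d]. *)
Definition graded (d : nat * nat * nat) i A : Prop :=
  [/\ uniq A, pivot_term i A &
    forall (U : zmodType) (f : nat -> U), pivot_rec f ->
      weight f d + \sum_(a <- A) f a = f i].

Lemma graded_contracted d e i A C :
  graded d i A -> contracted (graded e) A C -> uniq C -> graded (d + e) i C.
Proof.
move=> [uA tA wA] [j [B [A_j [_ tB wB] pC]]] uC; split=> //.
  exact: pivot_term_contract (pivot_term_lt tB) uA tA A_j pC.
move=> U f rec_f; rewrite weightD (perm_big _ pC) big_cat addrA.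
rewrite -[X in X + _]addrA wB // -(wA _ f rec_f).
by rewrite (perm_big _ (perm_to_rem A_j)) big_cons /= addrA.
Qed.

Lemma mulrn_true n : true *+ n = odd n.
Proof. by elim: n => //= n IHn; rewrite mulrS IHn. Qed.

Lemma mdeg_LBr w w' : mdeg (LBr w w') = mdeg w + mdeg w'.
Proof.
by move=> /=; case: (mdeg w) => -[? ?] ?; case: (mdeg w') => -[? ?] ?.
Qed.

Lemma mdeg_LSq w : mdeg (LSq w) = mdeg w + mdeg w.
Proof. by move=> /=; case: (mdeg w) => -[? ?] ?; rewrite -!addnn. Qed.

Lemma tdeg_LBr w w' : tdeg (LBr w w') = (tdeg w + tdeg w')%N.
Proof.
rewrite /tdeg /=.
by case: (mdeg w) => -[? ?] ?; case: (mdeg w') => -[? ?] ?; lia.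
Qed.

Lemma tdeg_LSq w : tdeg (LSq w) = (tdeg w).*2.
Proof. by rewrite /tdeg /=; case: (mdeg w) => -[? ?] ?; lia. Qed.

(* The constant function with value [1] modulo 2 satisfies the recurrence of the
   weights, and measures the parity. *)
Lemma graded_odd w i A : graded (mdeg w) i A -> odd (size A) = ~~ odd (tdeg w).
Proof.
move=> [_ _ /(_ bool (fun=> true) (fun=> erefl))].
rewrite big_const_seq count_predT iter_addr_0 /weight !mulrn_true /tdeg.
case: (mdeg w) => -[d1 d2] d3 /=; rewrite !oddD.
by do 4!case: (odd _).
Qed.

Definition vop_at_x_term i j A : Prop :=
  exists2 k, (i + 3 * k)%N = j & A = rev (pivot_prefix i k).

Lemma graded_vop (g : 'I_3) j A :
  vop_at_x_term g j A -> graded (mdeg (LGen g)) j A.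
Proof.
move=> [k <- ->]; split.
- by rewrite rev_uniq pivot_prefix_uniq.
- have [n [l [r [-> pr tr]]]] := pivot_term_prefix g k.
  by exists n, l, r; rewrite perm_rev.
- move=> U f rec_f; rewrite (perm_big (pivot_prefix g k)) ?perm_rev //=.
  rewrite -(sum_pivot_prefix _ _ rec_f); congr (_ + _); rewrite /weight.
  by case: g => -[|[|[|]]] //= _; rewrite !mulr0n ?mulr1n ?addr0 ?add0r.
Qed.

End Multidegrees.

(** * The transposed action on the dual of the Grassmann algebra *)

Section DualAction.
Local Open Scope fset_scope.
Local Open Scope ring_scope.
Variable K : fieldType.
Implicit Types (S : {fset nat}) (A B : op K) (w : mono).

Definition mono_of S : mono := sort leq S.
Definition dual := {fset nat} -> K^o.
Implicit Types (u v : dual).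

(* Passing to the dual turns formal sums, which represent elements of the
   Grassmann algebra non-uniquely, into honest linear maps; it reverses
   products. *)
Definition transp A u : dual :=
  fun S => \sum_(p <- A (mono_of S)) p.1 * u [fset x in p.2].

Definition mono_closed A : Prop :=
  forall w p, is_mono w -> p \in A w -> is_mono p.2.

Lemma dual_addE u v S : (u + v) S = u S + v S. Proof. by []. Qed.

Lemma dual_oppE u S : (- u) S = - u S. Proof. by []. Qed.

Lemma dual_scaleE (k : K) u S : (k *: u) S = k * u S. Proof. by []. Qed.

Definition dualE := (dual_addE, dual_oppE, dual_scaleE).

Lemma transp_is_linear A : linear (transp A).
Proof.
move=> k u v; apply/funext => S; rewrite !dualE /transp mulr_sumr -big_split.
by apply: eq_bigr => p _; rewrite /= !dualE mulrDr mulrCA.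
Qed.

HB.instance Definition _ A :=
  GRing.isLinear.Build K dual dual *:%R (transp A) (@transp_is_linear A).

Lemma mono_ofP S : is_mono (mono_of S).
Proof.
rewrite /is_mono ltn_sorted_uniq_leq sort_uniq fset_uniq.
exact: sort_sorted leq_total _.
Qed.

Lemma mem_mono_of S x : (x \in mono_of S) = (x \in S).
Proof. exact: mem_sort. Qed.

Lemma mono_ext w w' : is_mono w -> is_mono w' -> w =i w' -> w = w'.
Proof. exact: irr_sorted_eq ltn_trans ltnn w w'. Qed.

Lemma mono_ofK S : [fset x in mono_of S] = S.
Proof. by apply/fsetP => x; rewrite !inE mem_mono_of. Qed.

Lemma mono_of_fsetK w : is_mono w -> mono_of [fset x in w] = w.
Proof.
move=> mw; apply: mono_ext => // [|x]; first exact: mono_ofP.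
by rewrite mem_mono_of !inE.
Qed.

Lemma mono_uniq w : is_mono w -> uniq w.
Proof. by rewrite /is_mono ltn_sorted_uniq_leq => /andP[]. Qed.

Lemma mono_insert i w : is_mono w -> i \notin w -> is_mono (sort leq (i :: w)).
Proof.
move=> mw w_i.
rewrite /is_mono ltn_sorted_uniq_leq sort_uniq /= w_i mono_uniq //=.
exact: sort_sorted leq_total _.
Qed.

Lemma mono_rem i w : is_mono w -> is_mono (rem i w).
Proof. by apply: subseq_sorted (rem_subseq _ _); exact: ltn_trans. Qed.

Lemma mono_closed_comp A B :
  mono_closed A -> mono_closed B -> mono_closed (opcomp A B).
Proof.
move=> mA mB w p mw /flattenP[s /mapP[q qB ->] /mapP[r rA ->]] /=.
exact: mA (mB _ _ mw qB) rA.
Qed.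

Lemma mono_closed_add A B :
  mono_closed A -> mono_closed B -> mono_closed (opadd A B).
Proof. by move=> mA mB w p mw; rewrite mem_cat => /orP[/mA|/mB]; exact. Qed.

Lemma mono_closed_scale k A : mono_closed A -> mono_closed (opscale k A).
Proof. by move=> mA w p mw /mapP[q /mA mq ->]; exact: mq. Qed.

Lemma mono_closed_xop i : mono_closed (xop K i).
Proof.
move=> w p mw; rewrite /xop; case: ifPn => // w_i; rewrite inE => /eqP -> /=.
exact: mono_insert.
Qed.

Lemma mono_closed_dop i : mono_closed (dop K i).
Proof.
move=> w p mw; rewrite /dop; case: ifP => // _; rewrite inE => /eqP -> /=.
exact: mono_rem.
Qed.

Lemma transp_comp A B u :
  mono_closed B -> transp (opcomp A B) u = transp B (transp A u).
Proof.
move=> mB; apply/funext => S; rewrite /transp /opcomp /ext big_flatten big_map.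
apply: eq_big_seq => p pB; rewrite big_map mulr_sumr mono_of_fsetK.
  by apply: eq_bigr => q _; rewrite mulrA.
exact: mB (mono_ofP S) pB.
Qed.

Lemma transp_add A B u : transp (opadd A B) u = transp A u + transp B u.
Proof. by apply/funext => S; rewrite /transp /opadd big_cat. Qed.

Lemma transp_scale k A u : transp (opscale k A) u = k *: transp A u.
Proof.
apply/funext => S; rewrite dual_scaleE /transp big_map mulr_sumr.
by apply: eq_bigr => p _; rewrite mulrA.
Qed.

Lemma transp_id u : transp (idop K) u = u.
Proof. by apply/funext => S; rewrite /transp big_seq1 mul1r mono_ofK. Qed.

Definition sgn i S : K := sgn_before K i (mono_of S).

Lemma sgn_fset1U i j S :
  i \notin S -> sgn j (i |` S) = (-1) ^+ (i < j) * sgn j S.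
Proof.
move=> S_i; rewrite /sgn /sgn_before -exprD; congr (_ ^+ _).
suff /permP -> : perm_eq (mono_of (i |` S)) (i :: mono_of S) by [].
apply: uniq_perm => [||x]; rewrite /= ?mem_mono_of ?S_i ?mono_uniq ?mono_ofP //.
by rewrite !inE !mem_mono_of.
Qed.

Lemma sgn_fsetD1 i j S : i \in S -> sgn j (S `\ i) = (-1) ^+ (i < j) * sgn j S.
Proof.
move=> S_i; rewrite -[in RHS](fsetD1K S_i) sgn_fset1U ?fsetD11 //.
by rewrite mulrA -expr2 sqrr_sign mul1r.
Qed.

Lemma sgn_sqr i S : sgn i S * sgn i S = 1.
Proof. by rewrite -expr2 sqrr_sign. Qed.

Lemma sign_ltn_anti (i j : nat) : i != j ->
  (-1) ^+ (i < j)%N = - (-1) ^+ (j < i)%N :> K.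
Proof. by case: ltngtP => // _ _; rewrite ?opprK. Qed.

Definition xT i : {linear dual -> dual} := transp (xop K i).
Definition dT i : {linear dual -> dual} := transp (dop K i).

Lemma xTE i u S : xT i u S = if i \in S then 0 else sgn i S * u (i |` S).
Proof.
rewrite /xT /= /transp /xop mem_mono_of.
case: ifP => _; rewrite ?big_nil ?big_seq1 //=.
by congr (_ * u _); apply/fsetP => x; rewrite !inE mem_sort inE mem_mono_of.
Qed.

Lemma dTE i u S : dT i u S = if i \in S then sgn i S * u (S `\ i) else 0.
Proof.
rewrite /dT /= /transp /dop mem_mono_of.
case: ifP => _; rewrite ?big_nil ?big_seq1 //=.
congr (_ * u _); apply/fsetP => x.
by rewrite !inE mem_rem_uniq ?mono_uniq ?mono_ofP // inE mem_mono_of.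
Qed.

Lemma xT_sq i u : xT i (xT i u) = 0.
Proof. by apply/funext => S; rewrite !xTE fset1U1 mulr0 if_same. Qed.

Lemma xT_anti i j u : xT i (xT j u) = - xT j (xT i u).
Proof.
have [->|ij] := eqVneq i j; first by rewrite xT_sq oppr0.
apply/funext => S; rewrite dual_oppE !xTE !inE.
rewrite (negPf ij) [j == i]eq_sym (negPf ij) /=.
have [Si|Si] := boolP (i \in S); have [Sj|Sj] := boolP (j \in S);
  rewrite ?mulr0 ?oppr0 //.
rewrite !sgn_fset1U // fsetUCA (sign_ltn_anti ij) !mulNr mulrN !mulrA.
by congr (- (_ * _)); rewrite mulrAC [in RHS]mulrC mulrA.
Qed.

Lemma dT_xT i j u : dT i (xT j u) = - xT j (dT i u) + (i == j)%:R *: u.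
Proof.
apply/funext => S; rewrite !dualE dTE !xTE dTE !inE.
have [<-|ij] := eqVneq i j.
  have [Si|Si] := boolP (i \in S); rewrite /= ?oppr0 ?add0r mul1r.
    by rewrite sgn_fsetD1 // ltnn mul1r fsetD1K // mulrA sgn_sqr mul1r.
  by rewrite sgn_fset1U // ltnn mul1r fsetU1K // mulrA sgn_sqr mul1r addNr.
rewrite mul0r addr0 /=.
have [Si|Si] := boolP (i \in S); have [Sj|Sj] := boolP (j \in S);
  rewrite ?mulr0 ?oppr0 //=.
rewrite sgn_fsetD1 // sgn_fset1U //.
have -> : (j |` S) `\ i = j |` (S `\ i).
  by apply/fsetP => x; rewrite !inE; case: eqVneq => // ->; rewrite (negPf ij).
rewrite (sign_ltn_anti ij) !mulNr !mulrN !mulrA.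
by congr (- (_ * _)); rewrite mulrC [sgn i S * _]mulrC mulrA.
Qed.

End DualAction.

(** * Lie words as superderivations *)

Section LieWords.
Local Open Scope ring_scope.
Variable K : fieldType.
Implicit Types (i j k N : nat) (u : dual K) (S : {fset nat}) (w : lword).
Local Notation X := (@xT K).
Local Notation xprefix i k := (xprod X (rev (pivot_prefix i k))).

Lemma prefS i k :
  pref K i k.+1 = opcomp (xop K i) (opcomp (xop K i.+1) (pref K (i + 3) k)).
Proof.
rewrite /pref /= muln0 addn0 (iotaDl 1 0) foldr_map.
by do 2!congr opcomp; elim: (iota 0 k) => //= n s ->; rewrite mulnDr addnA.
Qed.

Lemma mono_closed_pref i k : mono_closed (pref K i k).
Proof.
elim: k i => [|k IHk] i; first by move=> w p mw; rewrite inE => /eqP ->.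
by rewrite prefS; do 2![apply: mono_closed_comp; first exact: mono_closed_xop].
Qed.

Lemma transp_pref i k u : transp (pref K i k) u = xprefix i k u.
Proof.
elim: k i u => [|k IHk] i u; first exact: transp_id.
have mono_p := @mono_closed_pref (i + 3) k.
have mono_xp := mono_closed_comp (@mono_closed_xop K i.+1) mono_p.
by rewrite prefS !transp_comp // IHk /= !rev_cons -!cats1 !xprod_cat.
Qed.

Lemma mono_closed_vop i : mono_closed (vop K i).
Proof.
move=> w p mw /flattenP[s /mapP[k _ ->]].
by apply: mono_closed_comp mw; [exact: mono_closed_pref|exact: mono_closed_dop].
Qed.

Lemma mono_closed_eval w : mono_closed (eval K w).
Proof.
elim: w => [i|w IHw w' IHw'|w IHw] /=; first exact: mono_closed_vop.
  apply: mono_closed_add; last apply: mono_closed_scale;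
    exact: mono_closed_comp.
exact: mono_closed_comp.
Qed.

Definition vop_summand i k u : dual K := dT K (i + 3 * k)%N (xprefix i k u).

Lemma vop_summand_xT i k j u :
  vop_summand i k (X j u) =
  - X j (vop_summand i k u) + (i + 3 * k == j)%N%:R *: xprefix i k u.
Proof.
rewrite /vop_summand -dT_xT X_xprod; last exact: xT_anti.
by rewrite size_rev size_pivot_prefix -signr_odd odd_double scale1r.
Qed.

Lemma sum_nat_widen (U : nmodType) (F : nat -> U) n N : (n <= N)%N ->
  (forall k, (n <= k)%N -> F k = 0) ->
  \sum_(0 <= k < n) F k = \sum_(0 <= k < N) F k.
Proof.
move=> le_nN F0; rewrite [RHS](big_cat_nat (n := n)) //=.
by rewrite [X in _ + X]big_nat [X in _ + X]big1 ?addr0 // => k /andP[/F0].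
Qed.

Lemma mem_leq_sumn (s : seq nat) x : x \in s -> (x <= sumn s)%N.
Proof. by move=> s_x; rewrite (perm_sumn (perm_to_rem s_x)) leq_addr. Qed.

Lemma transp_vopE i u S N : {in S, forall x, x < N}%N ->
  transp (vop K i) u S = \sum_(0 <= k < N) (vop_summand i k u S : K).
Proof.
move=> lt_N.
have summand0 k : (i + 3 * k)%N \notin S -> vop_summand i k u S = 0.
  by move=> S_k; rewrite /vop_summand dTE (negPf S_k).
pose M := maxn N (sumn (mono_of S)).+1.
transitivity (\sum_(0 <= k < M) (vop_summand i k u S : K)); last first.
  rewrite -(@sum_nat_widen _ _ N M) //; first exact: leq_maxl.
  by move=> k le_k; apply: summand0; apply/negP => /lt_N; lia.
rewrite -(@sum_nat_widen _ _ (sumn (mono_of S)).+1 M); first last.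
- move=> k le_k; apply: summand0; apply/negP.
  by rewrite -mem_mono_of => /mem_leq_sumn; lia.
- exact: leq_maxr.
rewrite /transp /vop big_flatten big_map; apply: eq_bigr => k _.
rewrite /vop_summand /dT /= -transp_pref -transp_comp //.
exact: mono_closed_dop.
Qed.

Definition vop_at_x i j u : dual K :=
  \sum_(0 <= k < j.+1) (i + 3 * k == j)%N%:R *: xprefix i k u.

Lemma in_span_vop_at_x i j : in_span X (vop_at_x_term i j) (vop_at_x i j).
Proof.
rewrite /vop_at_x /index_iota; elim: (iota _ _) => [|k s IHs].
  by apply: in_span_eq (in_span0 _ _) _ => u; rewrite big_nil.
have [ik_j|ik_j] := eqVneq (i + 3 * k)%N j; last first.
  by apply: in_span_eq IHs _ => u; rewrite big_cons (negPf ik_j) scale0r add0r.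
have span_k : in_span X (vop_at_x_term i j) (xprefix i k).
  by apply: in_span_xprod; exists k.
apply: in_span_eq (in_span_lin 1 span_k IHs) _ => u.
by rewrite big_cons ik_j eqxx.
Qed.

Lemma xT_transp_vopE i j u S N : {in S, forall x, x < N}%N -> (j < N)%N ->
  X j (transp (vop K i) u) S =
  \sum_(0 <= k < N) (X j (vop_summand i k u) S : K).
Proof.
move=> lt_N lt_jN; rewrite xTE; case: ifPn => S_j.
  by rewrite big1 // => k _; rewrite xTE S_j.
rewrite (@transp_vopE _ _ _ N); last first.
  by move=> x; rewrite !inE => /predU1P[->|/lt_N].
by rewrite mulr_sumr; apply: eq_bigr => k _; rewrite xTE (negPf S_j).
Qed.

Lemma superder_vop i : superder X (vop_at_x_term i) true (transp (vop K i)).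
Proof.
move=> j; exists (vop_at_x i j) => [|u]; first exact: in_span_vop_at_x.
apply/funext => S; rewrite dual_addE dual_scaleE expr1 mulN1r.
pose N := (sumn (mono_of S) + j).+1.
have lt_N x : x \in S -> (x < N)%N.
  by rewrite -mem_mono_of => /mem_leq_sumn; rewrite /N; lia.
have lt_jN : (j < N)%N by rewrite /N; lia.
have vop_at_x_S : vop_at_x i j u S = \sum_(0 <= k < N)
    ((i + 3 * k == j)%N%:R * xprefix i k u S : K).
  rewrite /vop_at_x fct_sumE (@sum_nat_widen _ _ j.+1 N) // => k lt_k.
  by case: eqP => [|_]; [lia|exact: mul0r].
rewrite (@transp_vopE _ _ _ N) // (xT_transp_vopE _ _ lt_N lt_jN) vop_at_x_S.
rewrite -sumrN -big_split; apply: eq_bigr => k _ /=.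
by rewrite vop_summand_xT.
Qed.

Lemma transp_eval_LBr w w' :
  transp (eval K (LBr w w')) =
  superbracket (odd (tdeg w')) (odd (tdeg w))
    (transp (eval K w')) (transp (eval K w)).
Proof.
have [mono_w mono_w'] := (@mono_closed_eval w, @mono_closed_eval w').
apply/funext => u; rewrite /= transp_add transp_scale !transp_comp //.
rewrite /superbracket -scaleNr andbC; congr (_ + _ *: _).
by case: (_ && _); rewrite ?opprK.
Qed.

Lemma transp_eval_LSq w :
  transp (eval K (LSq w)) = transp (eval K w) \o transp (eval K w).
Proof.
by apply/funext => u; rewrite /= transp_comp //; exact: mono_closed_eval.
Qed.

Lemma superder_eval w : wf w ->
  superder X (graded (mdeg w)) (odd (tdeg w)) (transp (eval K w)).
Proof.
elim: w => [g _|w IHw w' IHw' /andP[/IHw derw /IHw' derw']|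
            w IHw /andP[/IHw derw odd_w]].
- have -> : odd (tdeg (LGen g)) by rewrite /tdeg /=; case: g => -[|[|[|]]].
  by apply: superder_sub (superder_vop g) => j A; exact: graded_vop.
- rewrite transp_eval_LBr tdeg_LBr oddD addbC.
  apply: (superder_bracket (@xT_sq K) (@xT_anti K) derw' derw).
  + by move=> i A; exact: graded_odd.
  + by move=> i A; exact: graded_odd.
  + by move=> i A C; rewrite mdeg_LBr; exact: graded_contracted.
  + by move=> i A C; rewrite mdeg_LBr addrC; exact: graded_contracted.
- rewrite transp_eval_LSq tdeg_LSq odd_double mdeg_LSq; rewrite odd_w in derw.
  apply: (superder_square (@xT_sq K) (@xT_anti K) derw).
  + by move=> i A /graded_odd ->; rewrite odd_w.
  + by move=> i A C; exact: graded_contracted.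
Qed.

Lemma transp_eval_fset0 w u : transp (eval K w) u fset0 = 0.
Proof.
elim: w u => [g|w IHw w' IHw'|w IHw] u.
- by rewrite /= (@transp_vopE _ _ _ 0) ?big_nil // => x; rewrite inE.
- rewrite transp_eval_LBr /superbracket !dualE.
  by rewrite IHw IHw' mulr0 subr0.
- by rewrite transp_eval_LSq /= IHw.
Qed.

Lemma superder_eq0 P b (D : dual K -> dual K) :
    superder X P b D -> (forall u, D u fset0 = 0) -> (forall i A, ~ P i A) ->
  forall u, D u = 0.
Proof.
move=> derD D_fset0 P0 u; apply/funext => S.
elim/fset1U_rect: S u => [|i S S_i IHS] u; first exact: D_fset0.
have [L spanL DX] := derD i.
have := congr1 (fun v => v S) (DX u).
rewrite /= IHS !dualE (in_span_empty (@P0 i) spanL) addr0 xTE (negPf S_i).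
move=> /esym/eqP.
by rewrite !mulf_eq0 !signr_eq0 => /eqP.
Qed.

Lemma transp_indicator A (m t : mono) : mono_closed A -> is_mono m ->
  transp A (fun S => (mono_of S == t)%:R : K^o) [fset x in m]%fset =
  coef (A m) t.
Proof.
move=> mono_A mono_m; rewrite /transp /coef [RHS]big_mkcond mono_of_fsetK //.
apply: eq_big_seq => p pA; rewrite mono_of_fsetK; last exact: mono_A pA.
by case: eqP => _; rewrite ?mulr1 ?mulr0.
Qed.

Lemma Qcomp_nonzero_graded d : Qcomp_nonzero K d -> exists i A, graded d i A.
Proof.
move=> [w [wf_w <- [m [t [mono_m]]]]].
rewrite -transp_indicator //; last exact: mono_closed_eval.
move=> nonzero; apply: contrapT => no_term; case/eqP: nonzero.
have no_graded i A : ~ graded (mdeg w) i A.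
  by move=> gA; apply: no_term; exists i, A.
by rewrite (superder_eq0 (superder_eval wf_w) (@transp_eval_fset0 w) no_graded).
Qed.

Lemma Qcomp_nonzero_tail d : Qcomp_nonzero K d ->
  exists n r, [/\ uniq r, pivot_tail n r &
    forall (U : zmodType) (f : nat -> U), pivot_rec f ->
      weight f d + \sum_(a <- r) f a = f n].
Proof.
case/Qcomp_nonzero_graded=> i [A [uA [n [k [r [-> pA tail_r]]]] weight_A]].
exists n, r; split=> // [|U f rec_f].
  by move: uA; rewrite (perm_uniq pA) cat_uniq => /and3P[].
apply: (addIr (\sum_(a <- pivot_prefix n k) f a)).
rewrite -addrA [X in _ + X]addrC -big_cat -(perm_big _ pA) weight_A //.
by rewrite sum_pivot_prefix.
Qed.

End LieWords.

(** * Estimates *)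

Section GeometricSums.
Import Order.TTheory Num.Theory.
Local Open Scope ring_scope.
Variables (F : realFieldType) (t : F).
Hypothesis t_ge1 : 1 <= t.
Implicit Types (r : seq nat) (c n : nat).

Lemma sum_exp_le_geometric n r : uniq r -> {in r, forall x, (x < n)%N} ->
  \sum_(a <- r) t ^+ a <= \sum_(i < n) t ^+ i.
Proof.
move=> uniq_r lt_n; rewrite -(big_mkord xpredT (fun i => t ^+ i)).
have -> : \sum_(a <- r) t ^+ a = \sum_(0 <= i < n | i \in r) t ^+ i.
  rewrite -[RHS]big_filter; apply: perm_big; apply: uniq_perm => // [|x].
    by rewrite filter_uniq ?iota_uniq.
  rewrite mem_filter mem_index_iota /=.
  by case: (boolP (x \in r)) => // /lt_n ->.
rewrite [leLHS]big_mkcond ler_sum // => i _; case: ifP => // _.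
by rewrite exprn_ge0 // (le_trans ler01).
Qed.

Lemma sum_exp_le c n r : uniq r -> {in r, forall x, (x + c < n)%N} ->
  (t - 1) * t ^+ c * \sum_(a <- r) t ^+ a <= t ^+ n.
Proof.
move=> uniq_r lt_n; have t_ge0 : 0 <= t := le_trans ler01 t_ge1.
have [lt_cn|le_nc] := ltnP c n; last first.
  case: r uniq_r lt_n => [_ _|a r _ /(_ a (mem_head _ _))]; last by lia.
  by rewrite big_nil mulr0 exprn_ge0.
rewrite mulrAC -[in leRHS](subnK (ltnW lt_cn)) exprD ler_wpM2r ?exprn_ge0 //.
apply: (@le_trans _ _ (t ^+ (n - c) - 1)); last by rewrite gerBl.
rewrite subrX1 ler_wpM2l ?subr_ge0 // sum_exp_le_geometric // => x /lt_n.
by lia.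
Qed.

Lemma sum_exp_pivot_tail_le n r : t ^+ 2 <= t + 1 -> uniq r -> pivot_tail n r ->
  (t - 1) * t ^+ 2 * \sum_(a <- r) t ^+ a <= t ^+ n.
Proof.
move=> t2_le uniq_r tail_r.
have t_ge0 : 0 <= t := le_trans ler01 t_ge1.
have [r_n|r_n] := boolP ((n - 2 \in r) && (1 < n))%N; last first.
  apply: sum_exp_le => // x r_x.
  case: tail_r => lt_r; have := lt_r _ r_x; first lia.
  case=> [n_def|]; last lia.
  by case/andP: r_n; rewrite -n_def addnK; split=> //; lia.
have {r_n} [r_n n_ge2] := andP r_n.
have far : {in rem (n - 2)%N r, forall x, x + 2 < n - 2}%N.
  move=> x; rewrite mem_rem_uniq // inE => /andP[/eqP x_n /[dup] r_x].
  by case: tail_r => lt_r /lt_r; have := lt_r _ r_n; lia.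
rewrite (perm_big _ (perm_to_rem r_n)) big_cons mulrDr.
apply: (le_trans (lerD (lexx _) (sum_exp_le _ far))); first exact: rem_uniq.
rewrite -[in leRHS](subnK n_ge2) exprD -{2}[t ^+ (n - 2)]mul1r -mulrDl mulrC.
rewrite ler_wpM2l ?exprn_ge0 // -lerBrDr.
apply: le_trans (ler_wpM2l _ t2_le) _; first by rewrite subr_ge0.
by rewrite -subr_sqr expr1n.
Qed.

End GeometricSums.

Open Scope R_scope.

HB.instance Definition _ := Choice.copy C (R * R)%type.
HB.instance Definition _ :=
  GRing.isZmodule.Build C Cplus_assoc Cplus_comm Cplus_0_l
    (fun z => etrans (Cplus_comm (- z) z) (Cplus_opp_r z)).

Lemma CplusE (z w : C) : (z + w)%R = (z + w)%C.
Proof. by []. Qed.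

Lemma Cmulrn (z : C) n : (z *+ n)%R = (RtoC (INR n) * z)%C :> C.
Proof.
elim: n => [|n IHn]; first by rewrite mulr0n Cmult_0_l.
by rewrite mulrS IHn S_INR RtoC_plus CplusE; ring.
Qed.

Lemma Rmulrn (x : R) n : (x *+ n)%R = INR n * x.
Proof. by rewrite INRE RmultE mulr_natl. Qed.

Lemma Cmod_sum (r : seq nat) (z : nat -> C) :
  Cmod (\sum_(a <- r) z a)%R <= (\sum_(a <- r) Cmod (z a))%R.
Proof.
elim: r => [|a r IHr]; first by rewrite !big_nil Cmod_0; apply: Rle_refl.
rewrite !big_cons; apply: Rle_trans (Cmod_triangle _ _) _.
exact: Rplus_le_compat_l.
Qed.

Lemma sum_pow_pivot_tail_le (t : R) n r : 1 < t -> t ^ 2 <= t + 1 ->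
  uniq r -> pivot_tail n r ->
  (t - 1) * t ^ 2 * (\sum_(a <- r) pow t a)%R <= t ^ n.
Proof.
move=> t_gt1 t2_le uniq_r tail_r; apply/RleP.
rewrite !RpowE (eq_bigr (fun a => t ^+ a)%R) => [|a _]; last exact: RpowE.
apply: sum_exp_pivot_tail_le => //; first exact/RleP/Rlt_le.
by apply/RleP; rewrite -RpowE.
Qed.

Lemma pivot_rec_pow (t : R) : t ^ 3 - t - 2 = 0 -> pivot_rec (pow t).
Proof.
move=> t_root n; rewrite Rmulrn.
suff : t ^ n.+3 = t ^ n.+1 + 2 * t ^ n by [].
have -> : t ^ n.+3 = (t ^ 3 - t - 2) * t ^ n + (t + 2) * t ^ n.
  by rewrite /=; ring.
by rewrite t_root /=; ring.
Qed.

Lemma pivot_rec_Cpow (t : C) :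
  (t * t * t - t - RtoC 2)%C = RtoC 0 -> pivot_rec (Cpow t).
Proof.
move=> t_root n; rewrite Cmulrn.
suff : Cpow t n.+3 = (Cpow t n.+1 + RtoC 2 * Cpow t n)%C by [].
have -> : Cpow t n.+3 =
    ((t * t * t - t - RtoC 2) * Cpow t n + (t + RtoC 2) * Cpow t n)%C.
  by rewrite /=; ring.
by rewrite t_root /=; ring.
Qed.

Lemma weight_pow (t : R) n1 n2 n3 :
  weight (pow t) (n1, n2, n3) = INR n1 + INR n2 * t + INR n3 * t ^ 2 :> R.
Proof. by rewrite /weight !Rmulrn -!RplusE /=; ring. Qed.

Lemma weight_Cpow (t : C) n1 n2 n3 :
  weight (Cpow t) (n1, n2, n3) =
  (RtoC (INR n1) + RtoC (INR n2) * t + RtoC (INR n3) * (t * t))%C :> C.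
Proof. by rewrite /weight !Cmulrn !CplusE /=; ring. Qed.

Section CubicRoots.
Variables (lam : R) (mu : C).
Hypothesis lam_root : lam ^ 3 - lam - 2 = 0.

Lemma cubic_root_bounds : 1.521 < lam < 1.522.
Proof.
have factor a : (lam - a) * (lam ^ 2 + a * lam + a ^ 2 - 1) = - (a ^ 3 - a - 2).
  have -> : (lam - a) * (lam ^ 2 + a * lam + a ^ 2 - 1) =
    lam ^ 3 - lam - 2 - (a ^ 3 - a - 2) by ring.
  by rewrite lam_root; ring.
have cofactor_pos a : 1.5 < a -> 0 < lam ^ 2 + a * lam + a ^ 2 - 1.
  by move=> a_gt; have := pow2_ge_0 (lam + a / 2); nra.
have := cofactor_pos 1.521 ltac:(lra); have := factor 1.521.
have := cofactor_pos 1.522 ltac:(lra); have := factor 1.522.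
by split; nra.
Qed.

Lemma cubic_root_unique x : x ^ 3 - x - 2 = 0 -> x = lam.
Proof.
move=> x_root; have [lam_gt lam_lt] := cubic_root_bounds.
have : (x - lam) * ((x + lam / 2) ^ 2 + (3 * lam ^ 2 / 4 - 1)) = 0.
  have -> : (x - lam) * ((x + lam / 2) ^ 2 + (3 * lam ^ 2 / 4 - 1)) =
    (x ^ 3 - x - 2) - (lam ^ 3 - lam - 2) by field.
  by rewrite x_root lam_root; ring.
case/Rmult_integral; first lra.
by have := pow2_ge_0 (x + lam / 2); nra.
Qed.

Hypothesis mu_root : (mu * mu * mu - mu - RtoC 2)%C = RtoC 0.
Hypothesis Im_mu : 0 < Im mu.

Lemma Cmod_sqr_complex_root : Cmod mu ^ 2 = lam ^ 2 - 1.
Proof.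
move: mu_root Im_mu; case: mu => x y.
rewrite /Cminus /Cplus /Cmult /Copp /RtoC /=.
case=> re_eq im_eq y_pos; have y2 : y * y = 3 * (x * x) - 1 by nra.
have <- : - 2 * x = lam.
  apply: cubic_root_unique; rewrite /=.
  have : x * x * x - 3 * x * (y * y) - x - 2 = 0 by lra.
  by rewrite y2; lra.
by rewrite /Cmod /= !Rmult_1_r sqrt_sqrt; nra.
Qed.

Lemma Cmod_complex_root_bounds : 1.146 < Cmod mu < 1.1475.
Proof.
have := cubic_root_bounds; have := Cmod_sqr_complex_root; have := Cmod_ge_0 mu.
by split; nra.
Qed.

Lemma Cmod_complex_root_pow5_lt : Cmod mu ^ 5 < 2.
Proof.
have [rho_gt rho_lt] := Cmod_complex_root_bounds.
have rho2_lt : 0 < Cmod mu ^ 2 < 1.317 by nra.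
have rho4_lt : 0 < Cmod mu ^ 2 * Cmod mu ^ 2 < 1.735 by nra.
have -> : Cmod mu ^ 5 = Cmod mu * (Cmod mu ^ 2 * Cmod mu ^ 2) by ring.
by nra.
Qed.

Lemma weight_pow_lower_bound d n r : uniq r -> pivot_tail n r ->
  (weight (pow lam) d + \sum_(a <- r) pow lam a)%R = lam ^ n ->
  lam ^ n <= weight (pow lam) d * lam ^ 5.
Proof.
move=> uniq_r tail_r; rewrite -RplusE => weight_n.
have [lam_gt lam_lt] := cubic_root_bounds.
have lam_n : 0 < lam ^ n by apply: pow_lt; lra.
have lam5 : 8 <= lam ^ 5 by rewrite /=; nra.
have [lam_gt1 lam2_le] : 1 < lam /\ lam ^ 2 <= lam + 1 by split; nra.
have := sum_pow_pivot_tail_le lam_gt1 lam2_le uniq_r tail_r.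
set s := (\sum_(a <- r) _)%R in weight_n * => s_le.
set Y := weight _ _ in weight_n *.
have {}s_le : s <= 0.87 * lam ^ n by nra.
by nra.
Qed.

Lemma Cmod_weight_Cpow_upper_bound d n r : uniq r -> pivot_tail n r ->
  (weight (Cpow mu) d + \sum_(a <- r) Cpow mu a)%R = Cpow mu n ->
  Cmod (weight (Cpow mu) d) <= 6.5 * Cmod mu ^ n.
Proof.
move=> uniq_r tail_r weight_n; have [rho_gt rho_lt] := Cmod_complex_root_bounds.
have -> : weight (Cpow mu) d = (Cpow mu n - \sum_(a <- r) Cpow mu a)%R.
  by rewrite -weight_n addrK.
apply: Rle_trans (Cmod_triangle _ _) _; rewrite Cmod_opp Cmod_pow.
have := Cmod_sum r (Cpow mu).
rewrite (eq_bigr (pow (Cmod mu))) => [|a _]; last exact: Cmod_pow.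
have rho_n : 0 < Cmod mu ^ n by apply: pow_lt; lra.
have [rho_gt1 rho2_le] : 1 < Cmod mu /\ Cmod mu ^ 2 <= Cmod mu + 1.
  by split; nra.
have := sum_pow_pivot_tail_le rho_gt1 rho2_le uniq_r tail_r.
set s := (\sum_(a <- r) _)%R => s_le sum_le.
have c_ge : 0.19 <= (Cmod mu - 1) * Cmod mu ^ 2 by nra.
have {}s_le : s <= 5.5 * Cmod mu ^ n by nra.
by apply: Rle_trans (Rplus_le_compat_l _ _ _ sum_le) _; lra.
Qed.

End CubicRoots.

Lemma ln_gt0 x : 1 < x -> 0 < ln x.
Proof. by move=> x_gt1; rewrite -ln_1; apply: ln_increasing; lra. Qed.

Lemma Rpower_pow_ln x y n : 1 < x -> 0 < y ->
  Rpower (x ^ n) (ln y / ln x) = y ^ n.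
Proof.
move=> x_gt1 y_gt0; have ln_x := ln_gt0 x_gt1.
rewrite -!Rpower_pow; [|lra|lra]; rewrite Rpower_mult /Rpower; congr exp.
by field; lra.
Qed.

Lemma pow_le_Rpower x y z n k : 1 < x -> 1 < y -> 0 < z ->
  x ^ n <= z * x ^ k -> y ^ n <= Rpower z (ln y / ln x) * y ^ k.
Proof.
move=> x_gt1 y_gt1 z_gt0 xn_le; have y_gt0 : 0 < y by lra.
have xk_gt0 : 0 < x ^ k by apply: pow_lt; lra.
rewrite -!(Rpower_pow_ln _ x_gt1 y_gt0) Rpower_mult_distr //.
apply: Rle_Rpower_l.
  by apply: Rlt_le; apply: Rdiv_lt_0_compat; exact: ln_gt0.
by split=> //; apply: pow_lt; lra.
Qed.

Theorem theorem8p5 (K : fieldType) (lam : R) (mu : C)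
  (Hlam : lam ^ 3 - lam - 2 = 0)
  (Hmu : (mu * mu * mu - mu - RtoC 2)%C = RtoC 0)
  (Hmu_im : 0 < Im mu)
  (n1 n2 n3 : nat) (HQ : Qcomp_nonzero K (n1, n2, n3)) :
  let sigma := ln lam / ln (Cmod mu) in
  let Y1 := INR n1 + INR n2 * lam + INR n3 * lam ^ 2 in
  let z := (RtoC (INR n1) + RtoC (INR n2) * mu + RtoC (INR n3) * (mu * mu))%C in
  let Y2 := Re z in
  let Y3 := Im z in
  sqrt (Y2 ^ 2 + Y3 ^ 2) < 14 * Rpower Y1 (1 / sigma).
Proof.
move=> sigma Y1 z Y2 Y3; change (Cmod z < 14 * Rpower Y1 (1 / sigma)).
have [lam_gt _] := cubic_root_bounds Hlam.
have [rho_gt _] := Cmod_complex_root_bounds Hlam Hmu Hmu_im.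
have rho5 := Cmod_complex_root_pow5_lt Hlam Hmu Hmu_im.
have [n [r [uniq_r tail_r weight_n]]] := Qcomp_nonzero_tail HQ.
have Y1_ge : lam ^ n <= Y1 * lam ^ 5.
  rewrite /Y1 -weight_pow; apply: (weight_pow_lower_bound Hlam uniq_r tail_r).
  exact: weight_n (pivot_rec_pow Hlam).
have z_le : Cmod z <= 6.5 * Cmod mu ^ n.
  rewrite /z -weight_Cpow.
  apply: (Cmod_weight_Cpow_upper_bound Hlam Hmu Hmu_im uniq_r tail_r).
  exact: weight_n (pivot_rec_Cpow Hmu).
have Y1_pos : 0 < Y1.
  by have := pow_lt lam n ltac:(lra); have := pow_lt lam 5 ltac:(lra); nra.
have -> : 1 / sigma = ln (Cmod mu) / ln lam.
  by rewrite /sigma; field; split; apply: Rgt_not_eq; apply: ln_gt0; lra.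
have := @pow_le_Rpower lam (Cmod mu) Y1 n 5 ltac:(lra) ltac:(lra) Y1_pos Y1_ge.
set p := Rpower _ _ => p_ge; have p_pos : 0 < p by exact: exp_pos.
by nra.
Qed.
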